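(* Let $m>0$ and $\beta>0$, and consider the linearization of the biased bounded confidence model at the uniform state $P_n\equiv m$, $$\frac{dP_n}{dt}=m\big(-P_{n-2}+2P_{n-1}-(2+2\beta)P_n+(2+2\beta)P_{n+1}-P_{n+2}\big),\qquad n\in\mathbb{Z}.$$ For $\sigma\in[-\pi,\pi)$, $P_n(t)=e^{i\sigma n+\lambda t}$ is a solution if and only if $$\lambda=\lambda(\sigma)=m\big(-2\cos(2\sigma)+(4+2\beta)\cos\sigma-(2+2\beta)+2i\beta\sin\sigma\big).$$ If $\beta<2$, then $\max_{\sigma}\operatorname{Re}\lambda(\sigma)>0$, so that the uniform state is (spectrally) unstable. If $\beta\ge 2$, then $\operatorname{Re}\lambda(\sigma)\le 0$ for all $\sigma$; moreover, for $\beta>2$ the curve $\lambda(\sigma)$ has a quadratic tangency with the imaginary axis at the origin, i.e. $\lambda(0)=0$, $\frac{d}{d\sigma}\operatorname{Re}\lambda(0)=0$ and $\frac{d^2}{d\sigma^2}\operatorname{Re}\lambda(0)<0$.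
   Context: The biased bounded confidence model is the lattice system $\frac{dP_n}{dt}=2P_{n+1}P_{n-1}-P_n(P_{n+2}+P_{n-2})+\beta(P_{n+1}^2-P_n^2)$, $n\in\mathbb{Z}$, for which every constant sequence $P_n\equiv m$ is an equilibrium. *)

(* Defs.v *)
From Stdlib Require Export Reals ZArith.
From Coquelicot Require Export Coquelicot.

Open Scope R_scope.

(* Right-hand side of the biased bounded confidence model. *)
Definition bbc_rhs (beta : R) (P : Z -> R) (n : Z) : R :=
  2 * P (n + 1)%Z * P (n - 1)%Z - P n * (P (n + 2)%Z + P (n - 2)%Z)
  + beta * (P (n + 1)%Z ^ 2 - P n ^ 2).

(* The linearization, complexified so that it applies to complex exponentials. *)
Definition bbc_lin (m beta : R) (u : Z -> C) (n : Z) : C :=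
  (RtoC m *
    (- u (n - 2)%Z + RtoC 2 * u (n - 1)%Z - RtoC (2 + 2 * beta) * u n
     + RtoC (2 + 2 * beta) * u (n + 1)%Z - u (n + 2)%Z))%C.

(* [A] is the linearization of the real lattice vector field [F] at the state
   [P]: on real perturbations [p], every component of [A p] is the directional
   derivative of the corresponding component of [F] at [P] along [p]. *)
Definition is_linearization (F : (Z -> R) -> Z -> R) (P : Z -> R)
    (A : (Z -> C) -> Z -> C) : Prop :=
  forall (p : Z -> R) (n : Z),
    is_derive (K := R_AbsRing) (V := C_R_NormedModule)
      (fun e : R => RtoC (F (fun k => P k + e * p k) n)) 0
      (A (fun k => RtoC (p k)) n).

Definition is_lattice_solution (A : (Z -> C) -> Z -> C) (P : Z -> R -> C) : Prop :=
  forall (n : Z) (t : R),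
    is_derive (K := R_AbsRing) (V := C_R_NormedModule)
      (fun s : R => P n s) t (A (fun k => P k t) n).

Definition Cexp (z : C) : C :=
  (exp (Re z) * cos (Im z), exp (Re z) * sin (Im z)).

Definition normal_mode (sigma : R) (lambda : C) (n : Z) (t : R) : C :=
  Cexp (Ci * RtoC sigma * RtoC (IZR n) + lambda * RtoC t)%C.

Definition bbc_lambda (m beta sigma : R) : C :=
  (RtoC m *
    (RtoC (- 2 * cos (2 * sigma) + (4 + 2 * beta) * cos sigma - (2 + 2 * beta))
     + RtoC 2 * Ci * RtoC beta * RtoC (sin sigma)))%C.

(* Norms of complex sequences indexed by Z, with value p_infty outside the
   corresponding sequence space. *)
Definition linf_norm (u : Z -> C) : Rbar :=
  Lub_Rbar (fun x : R => exists n : Z, x = Cmod (u n)).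

(* The inner sum runs over the indices -N, ..., N. *)
Definition l2_norm (u : Z -> C) : Rbar :=
  Lub_Rbar (fun x : R => exists N : nat,
    x = sqrt (sum_n (fun k : nat => Cmod (u (Z.of_nat k - Z.of_nat N)%Z) ^ 2)
                (2 * N))).

(* [z] belongs to the resolvent set of [A] on the space of sequences of finite
   norm: [A - z] has a two-sided bounded inverse there.  Linearity of the
   inverse is automatic for linear [A]. *)
Definition in_resolvent_set (nrm : (Z -> C) -> Rbar)
    (A : (Z -> C) -> Z -> C) (z : C) : Prop :=
  exists (Rz : (Z -> C) -> Z -> C) (K : R),
    (forall v : Z -> C, is_finite (nrm v) ->
       is_finite (nrm (Rz v)) /\
       real (nrm (Rz v)) <= K * real (nrm v) /\
       forall n : Z, (A (Rz v) n - z * Rz v n)%C = v n) /\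
    (forall u : Z -> C, is_finite (nrm u) ->
       forall n : Z, Rz (fun k => (A u k - z * u k)%C) n = u n).

Definition in_spectrum (nrm : (Z -> C) -> Rbar)
    (A : (Z -> C) -> Z -> C) (z : C) : Prop :=
  ~ in_resolvent_set nrm A z.

Definition spectrally_unstable (nrm : (Z -> C) -> Rbar)
    (A : (Z -> C) -> Z -> C) : Prop :=
  exists z : C, in_spectrum nrm A z /\ 0 < Re z.

(* Main.v *)
(* The factorisation Re lambda(sigma) = 2 m (1 - cos sigma) (2 cos sigma - beta)
   decides the sign: for beta < 2 the maximum is at cos sigma = (2 + beta) / 4.
   Every lambda(sigma) lies in both spectra: plane waves are bounded
   eigenvectors, and their truncations are approximate eigenvectors in l2. *)
From Stdlib Require Import Lra Lia List.
Require Import Defs.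

(** * Derivatives of complex-valued functions and the complex exponential *)

(** Turns complex differentiation into two real problems that [auto_derive] can treat. One direction
    composes with the linear projections, the other with the pairing map. *)
Lemma is_derive_C (f : R -> C) (t : R) (l : C) :
  is_derive (K := R_AbsRing) (V := C_R_NormedModule) f t l <->
  is_derive (fun s => Re (f s)) t (Re l) /\
  is_derive (fun s => Im (f s)) t (Im l).
Proof.
  unfold is_derive; split.
  - intros H; split.
    + apply (filterdiff_comp' (K := R_AbsRing) (U := R_NormedModule)
               (V := C_R_NormedModule) (W := R_NormedModule) f Re t _ Re H).
      apply filterdiff_linear, is_linear_fst.
    + apply (filterdiff_comp' (K := R_AbsRing) (U := R_NormedModule)
               (V := C_R_NormedModule) (W := R_NormedModule) f Im t _ Im H).
      apply filterdiff_linear, is_linear_snd.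
  - intros [Hre Him].
    apply (filterdiff_ext (K := R_AbsRing) (U := R_NormedModule)
             (V := C_R_NormedModule) (fun s => (Re (f s), Im (f s)))).
    { intros s; symmetry; apply surjective_pairing. }
    eapply filterdiff_ext_lin.
    + apply (filterdiff_comp'_2 (K := R_AbsRing) (T := R_NormedModule)
               (U := R_NormedModule) (V := R_NormedModule)
               (W := C_R_NormedModule)
               _ _ (fun x y : R => (x, y)) t _ _ (fun x y : R => (x, y)) Hre Him).
      (* Up to surjective pairing, the pairing map is the identity from the product module to
         [C_R_NormedModule], hence its own differential. *)
      apply (filterdiff_ext (K := R_AbsRing)
               (U := prod_NormedModule R_AbsRing R_NormedModule R_NormedModule)
               (V := C_R_NormedModule) (fun x => x)).
      { intros x; apply surjective_pairing. }
      apply (filterdiff_ext_lin (K := R_AbsRing)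
               (U := prod_NormedModule R_AbsRing R_NormedModule R_NormedModule)
               (V := C_R_NormedModule) _ (fun x => x)).
      * apply filterdiff_id.
      * intros x; apply surjective_pairing.
    + intros y; reflexivity.
Qed.

Lemma is_derive_C_unique (f : R -> C) (t : R) (l1 l2 : C) :
  is_derive (K := R_AbsRing) (V := C_R_NormedModule) f t l1 ->
  is_derive (K := R_AbsRing) (V := C_R_NormedModule) f t l2 -> l1 = l2.
Proof.
  intros [Hre1 Him1]%is_derive_C [Hre2 Him2]%is_derive_C.
  apply is_derive_unique in Hre1, Him1, Hre2, Him2.
  apply injective_projections; unfold Re, Im in *; congruence.
Qed.

Lemma Cexp_plus (z w : C) : Cexp (z + w) = (Cexp z * Cexp w)%C.
Proof.
  destruct z as [a b], w as [c d]; unfold Cexp; cbn.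
  rewrite exp_plus, cos_plus, sin_plus.
  apply injective_projections; cbn; ring.
Qed.

Lemma Cmod_Cexp (z : C) : Cmod (Cexp z) = exp (Re z).
Proof.
  unfold Cmod, Cexp; cbn [fst snd].
  replace (_ + _) with (exp (Re z) ^ 2 * ((Rsqr (sin (Im z))) + Rsqr (cos (Im z))))
    by (unfold Rsqr; ring).
  rewrite sin2_cos2, Rmult_1_r; apply sqrt_pow2, Rlt_le, exp_pos.
Qed.

Lemma Cexp_neq_0 (z : C) : Cexp z <> 0.
Proof. apply Cmod_gt_0; rewrite Cmod_Cexp; apply exp_pos. Qed.

Lemma is_derive_Cexp_affine (z w : C) (t : R) :
  is_derive (K := R_AbsRing) (V := C_R_NormedModule)
    (fun s => Cexp (z + w * RtoC s)) t (w * Cexp (z + w * RtoC t))%C.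
Proof.
  destruct z as [a b], w as [c d].
  apply is_derive_C; cbn; split; auto_derive; trivial; unfold Rminus; ring.
Qed.

(** * Linearization and dispersion relation *)

Lemma bbc_lin_is_linearization (m beta : R) :
  is_linearization (bbc_rhs beta) (fun _ => m) (bbc_lin m beta).
Proof.
  intros p n; apply is_derive_C; unfold bbc_rhs, bbc_lin; cbn; split.
  - auto_derive; trivial; ring.
  (* The vector field is real, so its imaginary part is constantly 0; the operator likewise sends
     real sequences to real ones. *)
  - eapply is_derive_ext; [intros; reflexivity|].
    evar_last; [apply is_derive_const|]; unfold zero; cbn; ring.
Qed.

(** Each lattice shift multiplies a plane wave by a phase, so a translation-invariant operator such
    as [bbc_lin] acts on it as a scalar. *)
Lemma normal_mode_shift (sigma : R) (lambda : C) (n k : Z) (t : R) :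
  normal_mode sigma lambda (n + k) t =
  (normal_mode sigma lambda n t * (cos (sigma * IZR k), sin (sigma * IZR k)))%C.
Proof.
  unfold normal_mode.
  replace (Ci * RtoC sigma * RtoC (IZR (n + k)) + lambda * RtoC t)%C
    with ((Ci * RtoC sigma * RtoC (IZR n) + lambda * RtoC t)
          + (0, sigma * IZR k)%R)%C.
  - rewrite Cexp_plus; f_equal; unfold Cexp; cbn.
    rewrite exp_0; f_equal; ring.
  - rewrite plus_IZR; apply injective_projections; cbn; ring.
Qed.

Lemma bbc_lin_normal_mode (m beta sigma : R) (lambda : C) (t : R) (n : Z) :
  bbc_lin m beta (fun k => normal_mode sigma lambda k t) n =
  (bbc_lambda m beta sigma * normal_mode sigma lambda n t)%C.
Proof.
  unfold bbc_lin, Z.sub; rewrite !normal_mode_shift; cbn [Z.opp].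
  generalize (normal_mode sigma lambda n t); intros [a b].
  unfold bbc_lambda.
  replace (sigma * IZR (-2)) with (- (2 * sigma)) by (cbn; ring).
  replace (sigma * IZR (-1)) with (- sigma) by (cbn; ring).
  replace (sigma * IZR 1) with sigma by (cbn; ring).
  replace (sigma * IZR 2) with (2 * sigma) by (cbn; ring).
  rewrite !cos_neg, !sin_neg.
  apply injective_projections; cbn; ring.
Qed.

Lemma normal_mode_solution_iff (m beta sigma : R) (lambda : C) :
  is_lattice_solution (bbc_lin m beta) (normal_mode sigma lambda) <->
  lambda = bbc_lambda m beta sigma.
Proof.
  split.
  - intros H.
    (* One site and one time suffice: the derivative there is also [lambda] times the mode, and the
       mode never vanishes, so it can be cancelled. *)
    specialize (H 0%Z 0); rewrite bbc_lin_normal_mode in H.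
    pose proof (is_derive_C_unique _ _ _ _ H (is_derive_Cexp_affine _ _ _)) as E.
    fold (normal_mode sigma lambda 0 0) in E.
    assert (Hne : normal_mode sigma lambda 0 0 <> 0) by apply Cexp_neq_0.
    apply (f_equal (fun z => z / normal_mode sigma lambda 0 0)%C) in E.
    unfold Cdiv in E; rewrite <- !Cmult_assoc, Cinv_r, !Cmult_1_r in E by exact Hne.
    now symmetry.
  - intros H n t; rewrite bbc_lin_normal_mode, <- H.
    apply is_derive_Cexp_affine.
Qed.

(** * Sign of the real part and tangency at the origin *)

Lemma Re_bbc_lambda (m beta sigma : R) :
  Re (bbc_lambda m beta sigma) =
  m * (2 * (1 - cos sigma) * (2 * cos sigma - beta)).
Proof. unfold bbc_lambda; rewrite cos_2a_cos; cbn; ring. Qed.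

Lemma Re_bbc_lambda_max (m beta : R) (hm : 0 < m) (hbeta : 0 < beta < 2) :
  exists sigma0 : R,
    - PI <= sigma0 < PI /\
    (forall sigma : R,
       Re (bbc_lambda m beta sigma) <= Re (bbc_lambda m beta sigma0)) /\
    0 < Re (bbc_lambda m beta sigma0).
Proof.
  exists (acos ((2 + beta) / 4)).
  split; [|split].
  - destruct (acos_bound_lt ((2 + beta) / 4)); lra.
  - intros sigma; rewrite !Re_bbc_lambda, cos_acos by lra.
    apply Rmult_le_compat_l; [lra|].
    (* Completing the square in [cos sigma]: the two sides differ by four times this square. *)
    pose proof (pow2_ge_0 (cos sigma - (2 + beta) / 4)); nra.
  - rewrite Re_bbc_lambda, cos_acos by lra.
    (* The maximal value is [m * (2 - beta) ^ 2 / 4]. *)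
    apply Rmult_lt_0_compat; nra.
Qed.

Lemma Re_bbc_lambda_nonpos (m beta sigma : R) (hm : 0 < m) (hbeta : 2 <= beta) :
  Re (bbc_lambda m beta sigma) <= 0.
Proof.
  rewrite Re_bbc_lambda; pose proof (COS_bound sigma).
  assert (0 <= (1 - cos sigma) * (beta - 2 * cos sigma))
    by (apply Rmult_le_pos; lra).
  nra.
Qed.

Lemma bbc_lambda_0 (m beta : R) : bbc_lambda m beta 0 = RtoC 0.
Proof.
  unfold bbc_lambda; rewrite Rmult_0_r, cos_0, sin_0.
  apply injective_projections; cbn; ring.
Qed.

Lemma is_derive_Re_bbc_lambda (m beta sigma : R) :
  is_derive (fun s => Re (bbc_lambda m beta s)) sigma
    (m * (4 * sin (2 * sigma) - (4 + 2 * beta) * sin sigma)).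
Proof. cbn; auto_derive; trivial; ring. Qed.

Lemma is_derive_2_Re_bbc_lambda (m beta sigma : R) :
  is_derive_n (fun s => Re (bbc_lambda m beta s)) 2 sigma
    (m * (8 * cos (2 * sigma) - (4 + 2 * beta) * cos sigma)).
Proof.
  (* [is_derive_n] at order 2 is the derivative of the total function [Derive], which is first
     replaced by its closed form. *)
  apply (is_derive_ext
           (fun s => m * (4 * sin (2 * s) - (4 + 2 * beta) * sin s))).
  - intros s; symmetry; apply is_derive_unique, is_derive_Re_bbc_lambda.
  - auto_derive; trivial; ring.
Qed.

(** * Norms of sequences *)

(** The element [x0] rules out the value [m_infty], and the bound [B] rules out [p_infty]. *)
Lemma Lub_Rbar_bounded (E : R -> Prop) (x0 B : R) :
  E x0 -> (forall x, E x -> x <= B) ->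
  is_finite (Lub_Rbar E) /\ real (Lub_Rbar E) <= B.
Proof.
  intros Hx0 HB; destruct (Lub_Rbar_correct E) as [Hub Hlub].
  specialize (Hub x0 Hx0); specialize (Hlub (Finite B) HB).
  destruct (Lub_Rbar E); cbn in *; try easy.
Qed.

(** Finiteness matters because [real] sends the infinite values to 0. *)
Lemma Lub_Rbar_ge (E : R -> Prop) (x : R) :
  is_finite (Lub_Rbar E) -> E x -> x <= real (Lub_Rbar E).
Proof.
  intros Hf Hx; destruct (Lub_Rbar_correct E) as [Hub _].
  specialize (Hub x Hx); rewrite <- Hf in Hub; exact Hub.
Qed.

Lemma linf_norm_bounded (u : Z -> C) (B : R) :
  (forall n, Cmod (u n) <= B) ->
  is_finite (linf_norm u) /\ real (linf_norm u) <= B.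
Proof.
  intros H; apply (Lub_Rbar_bounded _ (Cmod (u 0%Z))); [eauto|].
  intros x [n ->]; apply H.
Qed.

Lemma Cmod_le_linf_norm (u : Z -> C) (n : Z) :
  is_finite (linf_norm u) -> Cmod (u n) <= real (linf_norm u).
Proof. intros H; apply Lub_Rbar_ge; eauto. Qed.

Lemma sum_n_indicator_le_1 (s c : Z) (n : nat) :
  sum_n (fun k => if Z.eq_dec (Z.of_nat k - c) s then 1 else 0) n <= 1.
Proof.
  (* Strengthened for the induction: the sum is still 0 while the window has not reached [s], so the
     single hit cannot be counted twice. *)
  enough (H : sum_n (fun k => if Z.eq_dec (Z.of_nat k - c) s then 1 else 0) n
              <= if Z_lt_dec (Z.of_nat n - c) s then 0 else 1)
    by (destruct Z_lt_dec; lra).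
  induction n as [|n IH].
  - rewrite sum_O; destruct Z.eq_dec, Z_lt_dec; try lra; lia.
  - rewrite sum_Sn; revert IH.
    change (@plus _) with Rplus.
    generalize (sum_n (fun k => if Z.eq_dec (Z.of_nat k - c) s then 1 else 0) n).
    intros x; change (AbelianMonoid.sort _) with R in x.
    destruct Z_lt_dec, Z.eq_dec, Z_lt_dec; intros IH; first [lia|lra].
Qed.

(** Induction on [L]: subtracting [B] times the indicator of the head makes [f] nonpositive there,
    which leaves the tail as support. Repeated entries in [L] are harmless, and the bound is uniform
    in the window. *)
Lemma sum_n_support (f : Z -> R) (L : list Z) (B : R) (c : Z) (n : nat) :
  0 <= B -> (forall k, f k <= B) -> (forall k, ~ In k L -> f k <= 0) ->
  sum_n (fun k => f (Z.of_nat k - c)%Z) n <= B * INR (length L).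
Proof.
  intros HB; revert f; induction L as [|s L IH]; intros f Hf HL.
  - cbn [length]; rewrite Rmult_0_r.
    apply (Rle_trans _ (sum_n (fun _ => 0) n)).
    + apply sum_n_m_le; intros k; apply HL; easy.
    + rewrite sum_n_const; lra.
  - pose (d := fun k : Z => if Z.eq_dec k s then 1 else 0).
    replace (sum_n (fun k => f (Z.of_nat k - c)%Z) n)
      with (sum_n (fun k => f (Z.of_nat k - c)%Z - B * d (Z.of_nat k - c)%Z) n
            + B * sum_n (fun k => d (Z.of_nat k - c)%Z) n).
    2:{ change (B * ?x) with (mult (K := R_Ring) B x).
        rewrite <- (sum_n_mult_l (K := R_Ring)), <- (sum_n_plus (G := R_AbelianMonoid)).
        apply sum_n_ext; intros k; unfold plus, mult; cbn; ring. }
    cbn [length]; rewrite S_INR.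
    assert (Hd : sum_n (fun k => d (Z.of_nat k - c)%Z) n <= 1)
      by apply sum_n_indicator_le_1.
    specialize (IH (fun k => f k - B * d k)).
    enough (sum_n (fun k => f (Z.of_nat k - c)%Z - B * d (Z.of_nat k - c)%Z) n
            <= B * INR (length L)) by nra.
    apply IH; intros k; [|intros Hk]; unfold d; destruct Z.eq_dec as [->|Hne].
    + specialize (Hf s); lra.
    + specialize (Hf k); lra.
    + specialize (Hf s); lra.
    + enough (f k <= 0) by lra.
      apply HL; intros [->|]; easy.
Qed.

Lemma l2_norm_support (u : Z -> C) (L : list Z) (B : R) :
  0 <= B -> (forall k, Cmod (u k) <= B) ->
  (forall k, ~ In k L -> u k = 0) ->
  is_finite (l2_norm u) /\ real (l2_norm u) <= B * sqrt (INR (length L)).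
Proof.
  intros HB Hu HL.
  eapply Lub_Rbar_bounded; [exists 0%nat; reflexivity|].
  intros x [N ->].
  rewrite <- (sqrt_pow2 B HB), <- sqrt_mult_alt by apply pow2_ge_0.
  apply sqrt_le_1_alt.
  apply (sum_n_support (fun k => Cmod (u k) ^ 2)).
  - apply pow2_ge_0.
  - intros k; apply pow_incr; split; [apply Cmod_ge_0|apply Hu].
  - intros k Hk; rewrite (HL k Hk), Cmod_0; lra.
Qed.

Lemma l2_norm_ge_window (u : Z -> C) (N : nat) :
  is_finite (l2_norm u) ->
  (forall k, (Z.abs k <= Z.of_nat N)%Z -> Cmod (u k) = 1) ->
  sqrt (INR (S (2 * N))) <= real (l2_norm u).
Proof.
  intros Hf Hu.
  replace (INR (S (2 * N)))
    with (sum_n (fun k => Cmod (u (Z.of_nat k - Z.of_nat N)%Z) ^ 2) (2 * N)).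
  - apply Lub_Rbar_ge; eauto.
  - rewrite (sum_n_ext_loc _ (fun _ => 1)).
    + rewrite sum_n_const; apply Rmult_1_r.
    + intros k Hk; rewrite Hu by lia; exact (pow1 2).
Qed.

(** * The spectrum of the linearization *)

Lemma Cmod_normal_mode_0 (sigma : R) (lambda : C) (n : Z) :
  Cmod (normal_mode sigma lambda n 0) = 1.
Proof.
  unfold normal_mode; rewrite Cmod_Cexp, <- exp_0; f_equal; cbn; ring.
Qed.

Lemma bbc_lambda_in_linf_spectrum (m beta sigma : R) :
  in_spectrum linf_norm (bbc_lin m beta) (bbc_lambda m beta sigma).
Proof.
  intros [Rz [K [Hbd Hinv]]].
  set (z := bbc_lambda m beta sigma) in *.
  pose (u := fun k : Z => normal_mode sigma z k 0).
  assert (Hu : is_finite (linf_norm u)).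
  { apply (linf_norm_bounded u 1); intros n; unfold u.
    rewrite Cmod_normal_mode_0; lra. }
  specialize (Hinv u Hu 0%Z).
  set (v := fun k : Z => (bbc_lin m beta u k - z * u k)%C) in *.
  destruct (linf_norm_bounded v 0) as [Hvf Hv].
  { intros n; unfold v, u; rewrite bbc_lin_normal_mode; fold z.
    rewrite <- Cmod_0; right; f_equal; ring. }
  assert (Hv0 : 0 <= real (linf_norm v)).
  { eapply Rle_trans; [apply Cmod_ge_0|apply (Cmod_le_linf_norm v 0 Hvf)]. }
  (* The residual [v] has norm 0, so [Rz v] has norm at most 0; but [Rz v] is the plane wave, of
     modulus 1. *)
  destruct (Hbd v Hvf) as [Hwf [Hw _]].
  pose proof (Cmod_le_linf_norm _ 0 Hwf) as H1.
  rewrite Hinv in H1; unfold u in H1; rewrite Cmod_normal_mode_0 in H1.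
  replace (real (linf_norm v)) with 0 in Hw by lra; lra.
Qed.

Definition truncate (N : nat) (u : Z -> C) (k : Z) : C :=
  if Z_le_dec (Z.abs k) (Z.of_nat N) then u k else 0.

Lemma Cmod_truncate_le (N : nat) (u : Z -> C) (B : R) :
  0 <= B -> (forall k, Cmod (u k) <= B) -> forall k, Cmod (truncate N u k) <= B.
Proof.
  intros HB Hu k; unfold truncate; destruct Z_le_dec; [auto|].
  rewrite Cmod_0; exact HB.
Qed.

Lemma l2_norm_truncate_finite (N : nat) (u : Z -> C) (B : R) :
  0 <= B -> (forall k, Cmod (u k) <= B) -> is_finite (l2_norm (truncate N u)).
Proof.
  intros HB Hu.
  apply (l2_norm_support _
           (map (fun k => Z.of_nat k - Z.of_nat N)%Z (seq 0 (S (2 * N)))) B HB).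
  - now apply Cmod_truncate_le.
  - intros k Hk; unfold truncate; destruct Z_le_dec; [|reflexivity].
    destruct Hk; apply in_map_iff; exists (Z.to_nat (k + Z.of_nat N)).
    split; [|apply in_seq]; lia.
Qed.

(** The factor [8 + 4 * beta] is the sum of the absolute values of the five stencil coefficients. *)
Lemma Cmod_bbc_lin_le (m beta B : R) (u : Z -> C) (n : Z) :
  0 <= m -> 0 <= beta -> (forall k, Cmod (u k) <= B) ->
  Cmod (bbc_lin m beta u n) <= m * ((8 + 4 * beta) * B).
Proof.
  intros Hm Hb Hu; unfold bbc_lin, Cminus.
  rewrite Cmod_mult, Cmod_R, Rabs_pos_eq by exact Hm.
  apply Rmult_le_compat_l; [exact Hm|].
  pose proof (Hu (n - 2)%Z); pose proof (Hu (n - 1)%Z); pose proof (Hu n).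
  pose proof (Hu (n + 1)%Z); pose proof (Hu (n + 2)%Z).
  eapply Rle_trans; [apply Cmod_triangle|].
  do 3 (eapply Rle_trans;
        [repeat apply Rplus_le_compat_r; apply Cmod_triangle|]).
  rewrite !Cmod_opp, !Cmod_mult, !Cmod_R, !Rabs_pos_eq by lra.
  nra.
Qed.

(** The stencil reaches two sites to each side, so truncating an eigenvector leaves a residual only
    where the stencil straddles a cut: four sites near each end. For small [N] these sites may
    coincide. *)
Lemma bbc_lin_truncate (m beta : R) (N : nat) (u : Z -> C) (z : C) (n : Z) :
  (forall k, bbc_lin m beta u k = (z * u k)%C) ->
  let M := Z.of_nat N in
  ~ In n (M - 1 :: M :: M + 1 :: M + 2
          :: 1 - M :: - M :: - M - 1 :: - M - 2 :: nil)%Z ->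
  (bbc_lin m beta (truncate N u) n - z * truncate N u n)%C = 0.
Proof.
  intros Hu M Hn; cbn [In] in Hn.
  (* Either the whole stencil lies inside the window, or it lies outside. *)
  assert (Z.abs n <= M - 2 \/ Z.abs n >= M + 3)%Z as [H|H] by lia.
  - replace (bbc_lin m beta (truncate N u) n) with (bbc_lin m beta u n).
    + rewrite Hu; unfold truncate; destruct Z_le_dec; [ring|lia].
    + unfold bbc_lin, truncate.
      repeat (destruct Z_le_dec; [|lia]); reflexivity.
  - unfold bbc_lin, truncate; repeat (destruct Z_le_dec; [lia|]); ring.
Qed.

(* The plane wave is not square summable, but truncating it to [-N, N] makes
   the residual O(1), supported on eight sites, while the norm grows like
   sqrt N: this is a Weyl sequence. *)
Lemma bbc_lambda_in_l2_spectrum (m beta sigma : R) :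
  0 <= m -> 0 <= beta ->
  in_spectrum l2_norm (bbc_lin m beta) (bbc_lambda m beta sigma).
Proof.
  intros Hm Hb [Rz [K [Hbd Hinv]]].
  set (z := bbc_lambda m beta sigma) in *.
  pose (e := fun k : Z => normal_mode sigma z k 0).
  assert (He : forall k, Cmod (e k) <= 1)
    by (intros k; unfold e; rewrite Cmod_normal_mode_0; lra).
  (* Pointwise bound for the residual of any sequence of modulus at most 1. *)
  pose (B := m * ((8 + 4 * beta) * 1) + Cmod z).
  assert (HB : 0 <= B).
  { unfold B; pose proof (Cmod_ge_0 z).
    enough (0 <= m * ((8 + 4 * beta) * 1)) by lra.
    apply Rmult_le_pos; lra. }
  (* Bound on the norm of [Rz v] that does not depend on [N]; the absolute value covers a negative
     [K]. Then [N] is taken with [T ^ 2 < N], which makes [sqrt (2 * N + 1)] exceed [T]. *)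
  pose (T := Rabs K * (B * sqrt (INR 8))).
  destruct (INR_unbounded (T ^ 2)) as [N HN].
  pose (u := truncate N e).
  assert (Hu1 : forall k, Cmod (u k) <= 1)
    by (apply Cmod_truncate_le; [lra|exact He]).
  assert (Huf : is_finite (l2_norm u))
    by (apply (l2_norm_truncate_finite N e 1); [lra|exact He]).
  pose (v := fun k : Z => (bbc_lin m beta u k - z * u k)%C).
  assert (Hv : is_finite (l2_norm v) /\ real (l2_norm v) <= B * sqrt (INR 8)).
  (* Only the length of the support is fixed here; its eight sites are filled in by unification with
     [bbc_lin_truncate]. *)
  { eapply (l2_norm_support v (_ :: _ :: _ :: _ :: _ :: _ :: _ :: _ :: nil));
      [exact HB| |].
    - intros k; unfold v, Cminus; eapply Rle_trans; [apply Cmod_triangle|].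
      rewrite Cmod_opp, Cmod_mult.
      pose proof (Cmod_bbc_lin_le m beta 1 u k Hm Hb Hu1).
      pose proof (Hu1 k); pose proof (Cmod_ge_0 z).
      unfold B; nra.
    - intros k; apply bbc_lin_truncate.
      intros j; apply bbc_lin_normal_mode. }
  destruct Hv as [Hvf Hv].
  destruct (Hbd v Hvf) as [Hwf [Hw _]].
  assert (H1 : sqrt (INR (S (2 * N))) <= real (l2_norm (Rz v))).
  { apply l2_norm_ge_window; [exact Hwf|].
    intros k Hk; unfold v; rewrite (Hinv u Huf k); unfold u, truncate.
    destruct Z_le_dec; [apply Cmod_normal_mode_0|easy]. }
  assert (Hv0 : 0 <= real (l2_norm v)).
  { eapply Rle_trans; [apply sqrt_pos|].
    apply Lub_Rbar_ge; [exact Hvf|exists 0%nat; reflexivity]. }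
  assert (H2 : K * real (l2_norm v) <= T).
  { unfold T; pose proof (Rle_abs K); pose proof (Rabs_pos K); nra. }
  assert (H3 : T < sqrt (INR (S (2 * N)))).
  { apply Rsqr_incrst_0; [|unfold T|apply sqrt_pos].
    - rewrite Rsqr_sqrt by apply pos_INR.
      rewrite Rsqr_pow2; eapply Rlt_le_trans; [exact HN|apply le_INR; lia].
    - apply Rmult_le_pos; [apply Rabs_pos|].
      apply Rmult_le_pos; [exact HB|apply sqrt_pos]. }
  lra.
Qed.

Theorem mainTheorem2 (m beta : R) (hm : 0 < m) (hbeta : 0 < beta) :
  is_linearization (bbc_rhs beta) (fun _ => m) (bbc_lin m beta) /\
  (forall (sigma : R) (lambda : C), - PI <= sigma < PI ->
     (is_lattice_solution (bbc_lin m beta) (normal_mode sigma lambda) <->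
      lambda = bbc_lambda m beta sigma)) /\
  (beta < 2 ->
     (exists sigma0 : R,
        - PI <= sigma0 < PI /\
        (forall sigma : R, - PI <= sigma < PI ->
           Re (bbc_lambda m beta sigma) <= Re (bbc_lambda m beta sigma0)) /\
        0 < Re (bbc_lambda m beta sigma0)) /\
     spectrally_unstable linf_norm (bbc_lin m beta) /\
     spectrally_unstable l2_norm (bbc_lin m beta)) /\
  (2 <= beta ->
     forall sigma : R, - PI <= sigma < PI ->
       Re (bbc_lambda m beta sigma) <= 0) /\
  (2 < beta ->
     bbc_lambda m beta 0 = RtoC 0 /\
     is_derive (fun sigma : R => Re (bbc_lambda m beta sigma)) 0 0 /\
     exists d2 : R,
       is_derive_n (fun sigma : R => Re (bbc_lambda m beta sigma)) 2 0 d2 /\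
       d2 < 0).
Proof.
  split; [apply bbc_lin_is_linearization|].
  split; [intros sigma lambda _; apply normal_mode_solution_iff|].
  split; [|split].
  - intros Hb.
    destruct (Re_bbc_lambda_max m beta hm (conj hbeta Hb))
      as [sigma0 [Hs0 [Hmax Hpos]]].
    split; [|split].
    + exists sigma0; auto.
    + exists (bbc_lambda m beta sigma0); split; [|exact Hpos].
      apply bbc_lambda_in_linf_spectrum.
    + exists (bbc_lambda m beta sigma0); split; [|exact Hpos].
      apply bbc_lambda_in_l2_spectrum; lra.
  - intros Hb sigma _; now apply Re_bbc_lambda_nonpos.
  - intros Hb; split; [apply bbc_lambda_0|split].
    + evar_last; [apply is_derive_Re_bbc_lambda|].
      rewrite Rmult_0_r, sin_0; ring.
    + eexists; split; [apply is_derive_2_Re_bbc_lambda|].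
      (* The second derivative at 0 is [2 * m * (2 - beta)]. *)
      rewrite Rmult_0_r, cos_0; nra.
Qed.
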